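(* For every instance of the reentrant flow shop problem with unit processing times, the Least Remaining Loops First (LRL) priority rule minimizes the total (unweighted) completion time, i.e., every schedule generated by LRL minimizes $\sum_{j=1}^n C_j$ among all schedules.
   Context: Reentrant flow shop with unit processing times: there are $m\ge 1$ machines in series and $n$ jobs. Job $j$ must traverse the shop $\mathcal{L}_j\ge 1$ times (loops $k=1,\dots,\mathcal{L}_j$, with $\mathcal{L}_j$ an integer). In each loop it is processed for one time unit on each of the machines $1,2,\dots,m$ in this order. Once a loop is started on machine $1$ it proceeds through all machines without waiting. A schedule is an assignment of start times $S_{jk}\in\{0,1,2,\dots\}$ on machine $1$ to all loops $(j,k)$ such that distinct loops have distinct start times and $S_{jk}\ge C_{j,k-1}$ for $k\ge 2$, where $C_{jk}=S_{jk}+m$ is the completion time of loop $k$ of job $j$ on machine $m$. The completion time of job $j$ is $C_j=C_{j\mathcal{L}_j}$. Job $j$ is available at time $t$ if it still has loops that have not been started before $t$ and all its previously started loops are completed on machine $m$ by time $t$. Its number of remaining loops at that time is the number of its loops not yet started. The LRL priority rule: at each time $t=0,1,2,\dots$ at which at least one job is available, start on machine $1$ the next loop of an available job with the least number of remaining loops among all available jobs (ties broken arbitrarily); machine $1$ is idle only if no job is available. *)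

(* Defs.v *)
From mathcomp Require Import all_boot.

Set Implicit Arguments.
Unset Strict Implicit.
Unset Printing Implicit Defensive.

(* An instance is given by the number m of machines, the number n of jobs and
   the numbers of loops L : 'I_n -> nat.  The loops of job j are numbered
   1, ..., L j.  A family of start times is a function S : 'I_n -> nat -> nat
   in which S j k is meaningful only when k is a loop of j; every definition
   below ignores the other values. *)

Section ReentrantFlowShop.
Variables (m n : nat) (L : 'I_n -> nat).
Implicit Types (S : 'I_n -> nat -> nat) (j : 'I_n) (k t : nat).

Definition is_loop j k : bool := 0 < k <= L j.

Definition loop_completion S j k : nat := S j k + m.

Definition job_completion S j : nat := loop_completion S j (L j).

Definition total_completion S : nat := \sum_(j < n) job_completion S j.

(* Distinctness of the start times on machine 1 suffices for all machines: a
   loop occupies machine i exactly during the time unit starting at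
   S j k + i - 1. *)
Definition schedule S : Prop :=
  (forall j k j' k', is_loop j k -> is_loop j' k' ->
     (j, k) <> (j', k') -> S j k <> S j' k') /\
  (forall j k, is_loop j k -> 2 <= k -> loop_completion S j k.-1 <= S j k).

Definition started_before S t j k : bool := S j k < t.

Definition remaining S t j : nat :=
  \sum_(1 <= k < (L j).+1) ~~ started_before S t j k.

Definition available S t j : Prop :=
  (exists k, is_loop j k /\ ~~ started_before S t j k) /\
  (forall k, is_loop j k -> started_before S t j k ->
     loop_completion S j k <= t).

Definition next_loop S t j k : Prop :=
  [/\ is_loop j k, ~~ started_before S t j k &
      forall k', is_loop j k' -> k' < k -> started_before S t j k'].

(* Whenever some job is available, the next loop
   of an available job with least number of remaining loops starts; no other
   loop starts then, since start times in a schedule are distinct, and no loop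
   starts at other times, since a loop of a schedule can only start when its
   job is available. *)
Definition LRL_schedule S : Prop :=
  schedule S /\
  forall t, (exists j, available S t j) ->
    exists j k,
      [/\ available S t j,
          forall j', available S t j' -> remaining S t j <= remaining S t j',
          next_loop S t j k &
          S j k = t].

End ReentrantFlowShop.

(* Main.v *)
Require Import Defs.
From mathcomp Require Import all_boot zify.
Set Implicit Arguments.
Unset Strict Implicit.
Unset Printing Implicit Defensive.

(** Write C_j for the completion time of job j and s_j for the start of its
    first loop.  Under LRL a job that has been started is never interrupted:
    when one of its loops completes it has strictly fewer remaining loops than
    it had when that loop was preferred to all the other available jobs
    ([no_preemption]).  Hence C_j = s_j + m L_j, and the order of the first
    starts is an order of nondecreasing L_j; in this order LRL is the shortest
    processing time rule on m parallel tracks, the residues modulo m of the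
    time slots.

    Both sides of the inequality are cut into blocks of m consecutive jobs,
    from the last job downwards; the last block to be cut may be smaller.
    For any schedule, let J be a set of jobs, r the minimum of |J| and m, and T
    the r jobs of J that complete last.  Then
      0 + 1 + ... + (r - 1) + m * (sum of L over J) <= sum of C over T
    ([top_completions_ge]): at each time u the number of jobs of J in progress
    is at most the number of jobs of T that are not complete, and, because one
    loop at most starts in each time slot, u + 1 at most.  For LRL, let D_k be
    the first k jobs.  The (p + m)-th job starts no later than the p-th job
    completes, and one of the first m jobs starts no later than the slot given
    by its rank, so
      sum of s over D_k <= 0 + ... + (r - 1) + sum of C over D_(k - m),
    where r is the minimum of k and m ([sum_starts_le]).  Adding m * L_j for
    each job turns the left-hand side into the sum of C over D_k.  Among the
    sets of k jobs D_k has the fewest loops ([exchange_sum]), so strong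
    induction on k shows that the sum of C over D_k is at most the sum of the
    completion times, in any schedule, of any k jobs ([LRL_first_jobs_le]).
    The theorem is the case of all n jobs. *)

(** * Finite sets and sums *)
(** The two set differences have the same cardinality, and the largest value of
    [f] on [D :\: J] separates the values on one from those on the other. *)
Lemma exchange_sum (I : finType) (D J : {set I}) (f : I -> nat) :
    #|D| = #|J| -> (forall i j, i \in D -> j \notin D -> f i <= f j) ->
  \sum_(i in D) f i <= \sum_(i in J) f i.
Proof.
move=> eqDJ lef.
rewrite (big_setID J) /= [leqRHS](big_setID D) /= [J :&: D]setIC leq_add2l.
have cardDJ: #|D :\: J| = #|J :\: D|.
  by move: eqDJ (cardsID J D) (cardsID D J); rewrite [J :&: D]setIC; lia.
set a := \max_(i in D :\: J) f i.
apply: (@leq_trans (#|D :\: J| * a)).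
  by rewrite -sum_nat_const; apply: leq_sum => i Di; apply: leq_bigmax_cond.
rewrite cardDJ -sum_nat_const; apply: leq_sum => j /setDP[_ nDj].
by apply/bigmax_leqP => i /setDP[Di _]; apply: lef.
Qed.

Lemma exists_top (I : finType) (J : {set I}) (f : I -> nat) r :
    r <= #|J| ->
  exists T : {set I}, [/\ T \subset J, #|T| = r &
    forall i j, i \in J :\: T -> j \in T -> f i <= f j].
Proof.
elim: r => [|r IH] ler.
  by exists set0; split; rewrite ?sub0set ?cards0 // => i j _; rewrite inE.
have [T [TJ cT topT]] := IH (ltnW ler).
have /card_gt0P[x0 x0P] : 0 < #|J :\: T|.
  by have := cardsID T J; rewrite (setIidPr TJ); lia.
case: (arg_maxnP (P := mem (J :\: T)) f x0P) => x /= xJT xmax.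
have [xJ xT] := setDP xJT.
exists (x |: T); split.
- by rewrite subUset sub1set xJ.
- by rewrite cardsU1 xT cT.
move=> i j; rewrite !inE negb_or => /andP[/andP[nix niT] iJ].
have iJT : i \in J :\: T by rewrite inE niT.
by case/orP => [/eqP->|jT]; [apply: xmax | apply: topT].
Qed.

Lemma count_le1 (T : eqType) (P : pred T) (s : seq T) :
    uniq s -> {in s &, forall x y, P x -> P y -> x = y} -> count P s <= 1.
Proof.
move=> us inj; rewrite -size_filter.
have := filter_uniq P us.
have: {subset filter P s <= [pred x | P x && (x \in s)]}.
  by move=> x; rewrite mem_filter.
case: (filter P s) => [|x [|y l]] //= sub /andP[].
rewrite inE negb_or => /andP[/eqP nxy _] _.
have /andP[Px sx] := sub x (mem_head _ _).
have /andP[Py sy] := sub y (mem_behead (s := [:: x, y & l]) (mem_head _ _)).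
by case: nxy; apply: inj.
Qed.

(** * Loops in progress and the lower bound for arbitrary schedules *)

Section Schedules.
Variables (m n : nat) (L : 'I_n -> nat) (S : 'I_n -> nat -> nat).
Hypothesis S_sched : schedule m L S.

Lemma start_inj j k j' k' : is_loop L j k -> is_loop L j' k' ->
  S j k = S j' k' -> j = j' /\ k = k'.
Proof.
move=> lk lk' eqS; case: (eqVneq (j, k) (j', k')) => [[-> ->] //|/eqP ne].
by case: S_sched => /(_ j k j' k' lk lk' ne).
Qed.

Lemma start_gap j k k' : is_loop L j k -> is_loop L j k' -> k < k' ->
  S j k + m <= S j k'.
Proof.
move=> /andP[k0 _]; elim: k' => // k' IH lk'; rewrite ltnS leq_eqVlt.
have [_ prec] := S_sched.
have := prec j k'.+1 lk'; rewrite /loop_completion /= => precS.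
case/orP => [/eqP eqk|lt]; first by subst k'; apply: precS; lia.
have lk1 : is_loop L j k' by move: lk'; rewrite /is_loop; lia.
have := IH lk1 lt; have := precS ltac:(lia); lia.
Qed.

Lemma mem_loops j k : (k \in iota 1 (L j)) = is_loop L j k.
Proof. by rewrite mem_iota add1n ltnS. Qed.

(** A count rather than a boolean, so that summing over time gives the total
    work of the job at once; [in_progress_le] shows that it is 0 or 1. *)
Definition in_progress t j : nat :=
  count (fun k => S j k <= t < S j k + m) (iota 1 (L j)).

Definition starts (J : {set 'I_n}) : seq nat :=
  [seq S j k | j <- enum J, k <- iota 1 (L j)].

Lemma starts_uniq J : uniq (starts J).
Proof.
apply: allpairs_uniq_dep; rewrite ?enum_uniq //.
  by move=> j _; apply: iota_uniq.
move=> _ _ /allpairsPdep[j [k [_ + ->]]] /allpairsPdep[j' [k' [_ + ->]]] /=.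
by rewrite !mem_loops => lk lk' /(start_inj lk lk')[-> ->].
Qed.

Lemma sum_in_progress t (J : {set 'I_n}) :
  \sum_(j in J) in_progress t j = count (fun v => v <= t < v + m) (starts J).
Proof.
rewrite count_flatten -map_comp sumnE big_map big_enum /=.
by apply: eq_bigr => j _; rewrite count_map.
Qed.

Lemma mem_window t v :
  (v \in iota (t.+1 - m) (minn m t.+1)) = (v <= t < v + m).
Proof. rewrite mem_iota; lia. Qed.

(** A loop in progress at time [t] started in one of the last [m] slots up to
    [t], of which only [t + 1] exist when [t < m], and start times are
    distinct. *)
Lemma sum_in_progress_le t (J : {set 'I_n}) :
  \sum_(j in J) in_progress t j <= minn m t.+1.
Proof.
rewrite sum_in_progress -size_filter -[leqRHS](size_iota (t.+1 - m)).
apply: uniq_leq_size; first by rewrite filter_uniq ?starts_uniq.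
by move=> v; rewrite mem_filter mem_window => /andP[].
Qed.

Lemma sum_in_progress_ge t :
    (forall v, v <= t -> exists j k, is_loop L j k /\ S j k = v) ->
  minn m t.+1 <= \sum_(j in [set: 'I_n]) in_progress t j.
Proof.
move=> busy; rewrite sum_in_progress -size_filter -[leqLHS](size_iota (t.+1 - m)).
apply: uniq_leq_size; first exact: iota_uniq.
move=> v; rewrite mem_window mem_filter => vP; rewrite vP /=.
case/andP: vP => /busy[j [k [lk <-]]] _.
by apply/allpairsPdep; exists j, k; rewrite mem_enum inE mem_loops.
Qed.

Lemma in_progress_le t j :
  in_progress t j <= (S j 1 <= t < job_completion m L S j).
Proof.
have count1 : in_progress t j <= 1.
  apply: count_le1 => [|k k']; first exact: iota_uniq.
  rewrite !mem_loops => lk lk' Pk Pk'.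
  by case: (ltngtP k k') => // [/(start_gap lk lk')|/(start_gap lk' lk)]; lia.
case: (boolP (_ <= t < _)) => // out.
rewrite leqn0 -[_ == 0]negbK -lt0n -has_count.
apply: contra out => /hasP[k]; rewrite mem_loops => lk tP.
rewrite /job_completion /loop_completion.
have l1 : is_loop L j 1 by move: lk; rewrite /is_loop; lia.
have lL : is_loop L j (L j) by move: lk; rewrite /is_loop; lia.
have S1k : S j 1 <= S j k.
  case: (ltngtP 1 k) => [/(start_gap l1 lk)||<-] //; move: lk; rewrite /is_loop; lia.
have SkL : S j k <= S j (L j).
  case: (ltngtP k (L j)) => [/(start_gap lk lL)||<-] //; move: lk; rewrite /is_loop; lia.
lia.
Qed.

Lemma sum_window a U : a + m <= U -> \sum_(u < U) (a <= u < a + m) = m.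
Proof.
move=> le; rewrite -(big_mkord xpredT (fun u => (a <= u < a + m) : nat)).
rewrite (@big_cat_nat _ _ _ a) //=; last lia.
rewrite (@big_cat_nat _ _ _ (a + m) a) //=; last lia.
rewrite big_nat_cond big1 => [|i]; last by lia.
rewrite [X in _ + (_ + X)]big_nat_cond [X in _ + (_ + X)]big1 => [|i]; last by lia.
rewrite (eq_big_nat _ _ (F2 := fun=> 1)) => [|i]; last by lia.
by rewrite sum_nat_const_nat; lia.
Qed.

Lemma sum_time_in_progress j U : job_completion m L S j <= U ->
  \sum_(u < U) in_progress u j = m * L j.
Proof.
rewrite /job_completion /loop_completion => CU.

under eq_bigr do rewrite /in_progress -sum1_count big_mkcond /=.
rewrite exchange_big /= (eq_big_seq (fun=> m)) => [|k].
  by rewrite big_const_seq count_predT size_iota iter_addn_0.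
rewrite mem_loops => lk; rewrite -[RHS](@sum_window (S j k) U); last first.
  have lL : is_loop L j (L j) by move: lk; rewrite /is_loop; lia.
  case: (ltngtP k (L j)) => [/(start_gap lk lL)||eqk]; first by lia.
    by move: lk; rewrite /is_loop; lia.
  by rewrite eqk.
by apply: eq_bigr => u _; case: ifP.
Qed.

(** Both sides are sums over the times [u].  The triangular number is the
    capacity lost while machine 1 feeds in the first loops: at a time [u < r]
    at most [u + 1] of the [r] jobs of [T] can be in progress. *)
Lemma top_completions_ge (J T : {set 'I_n}) :
    T \subset J -> #|T| = minn #|J| m ->
    (forall i j, i \in J :\: T -> j \in T ->
       job_completion m L S i <= job_completion m L S j) ->
  \sum_(p < minn #|J| m) p + m * \sum_(j in J) L j
    <= \sum_(j in T) job_completion m L S j.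
Proof.
set r := minn _ _ => TJ cT topT; set C := job_completion m L S.
pose U := r + \sum_j C j.
have CU j : C j <= U.
  by apply: leq_trans (leq_addl _ _); rewrite (bigD1 j) //= leq_addr.
have Cm j : m <= C j by rewrite /C /job_completion /loop_completion leq_addl.
have layer j : C j = \sum_(u < U) (u < C j).
  rewrite -(big_mkord xpredT (fun u => (u < C j) : nat)).
  rewrite (@big_cat_nat _ _ _ (C j)) //=.
  rewrite (eq_big_nat _ _ (F2 := fun=> 1)) => [|i]; last by lia.
  rewrite [X in _ + X]big_nat_cond [X in _ + X]big1 => [|i]; last by lia.
  by rewrite sum_nat_const_nat; lia.
have loss : \sum_(p < r) p = \sum_(u < U) (r - u.+1).
  rewrite -(big_mkord xpredT (fun u => r - u.+1)).
  rewrite (@big_cat_nat _ _ _ r) //=; last by rewrite leq_addr.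
  rewrite [X in _ + X]big_nat_cond [X in _ + X]big1 => [|i]; last by lia.
  by rewrite addn0 big_mkord (reindex_inj rev_ord_inj).
rewrite loss big_distrr /=.
under [X in _ + X <= _]eq_bigr => j _ do rewrite -(sum_time_in_progress (CU j)).
under [leqRHS]eq_bigr => j _ do rewrite layer.
rewrite exchange_big [leqRHS]exchange_big -big_split /=.
apply: leq_sum => u _.
(* Until the first completion in T, the count is bounded by the number r of
   jobs of T; afterwards the jobs of J outside T are complete, and u >= m >= r
   leaves no initial loss. *)
have [allT|] := boolP [forall j in T, u < C j].
  have -> : \sum_(j in T) (u < C j) = r.
    rewrite -cT -sum1_card; apply: eq_bigr => j jT.
    by rewrite (forall_inP allT).
  have := sum_in_progress_le u J.
  have : \sum_(j in J) in_progress u j <= #|J|.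
    rewrite -sum1_card; apply: leq_sum => j _.
    by apply: leq_trans (in_progress_le _ _) (leq_b1 _).
  rewrite /r; move: (\sum_(i in J) _) (#|J|) => a c; lia.
rewrite negb_forall_in => /exists_inP[j0 j0T]; rewrite -leqNgt => Cu.
have -> : r - u.+1 = 0 by move: (Cm j0); rewrite /r; lia.
rewrite (big_setID T) /= (setIidPr TJ) [X in 0 + (_ + X)]big1 ?addn0 ?add0n => [|i iJT].
  apply: leq_sum => j _; apply: leq_trans (in_progress_le _ _) _.
  by rewrite -/(C j); case: (u < C j); rewrite ?andbF ?leq_b1.
apply/eqP; rewrite -leqn0; apply: leq_trans (in_progress_le _ _) _.
by rewrite ltnNge (leq_trans (topT _ _ iJT j0T) Cu) andbF.
Qed.

End Schedules.

(** * The structure of LRL schedules *)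

Section LRL.
Variables (m n : nat) (L : 'I_n -> nat) (S : 'I_n -> nat -> nat).
Hypotheses (m_gt0 : 0 < m) (L_gt0 : forall j, 0 < L j).
Hypothesis S_LRL : LRL_schedule m L S.

Let S_sched : schedule m L S := S_LRL.1.

Lemma is_loop1 j : is_loop L j 1.
Proof. exact: L_gt0. Qed.

Lemma remaining_eq t j k : is_loop L j k ->
    (forall i, is_loop L j i -> i < k -> S j i < t) ->
    (forall i, is_loop L j i -> k <= i -> t <= S j i) ->
  remaining L S t j = (L j).+1 - k.
Proof.
move=> /andP[k0 kL] before after; rewrite /remaining /started_before.
rewrite (@big_cat_nat _ _ _ k) //=; last lia.
rewrite big_nat_cond big1 ?add0n => [|i]; last first.
  rewrite andbT => iP; rewrite before //; rewrite /is_loop; lia.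
rewrite (eq_big_nat _ _ (F2 := fun=> 1)) => [|i iP].
  by rewrite sum_nat_const_nat muln1.
by rewrite -leqNgt after //; rewrite /is_loop; lia.
Qed.

Lemma available_loop t j k : is_loop L j k -> t <= S j k ->
    (forall i, is_loop L j i -> i < k -> S j i + m <= t) ->
  available m L S t j /\ remaining L S t j = (L j).+1 - k.
Proof.
move=> lk tk before.
have after i : is_loop L j i -> k <= i -> t <= S j i.
  move=> li; rewrite leq_eqVlt => /orP[/eqP<- //|ki].
  have := start_gap S_sched lk li ki; lia.
split.
  split; first by exists k; rewrite /started_before -leqNgt.
  move=> i li; rewrite /started_before /loop_completion => it.
  apply: before => //; rewrite ltnNge; apply/negP => /(after i li); lia.
by apply: remaining_eq => // i li ik; have := before i li ik; lia.
Qed.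

(** Start times are distinct, so the loop that the rule selects at time [S j k]
    is loop [k] of [j] itself. *)
Lemma LRL_least j k j' : is_loop L j k -> available m L S (S j k) j' ->
  (L j).+1 - k <= remaining L S (S j k) j'.
Proof.
move=> lk av'.
have [av rem] : available m L S (S j k) j /\ remaining L S (S j k) j = (L j).+1 - k.
  by apply: available_loop => // i li ik; have := start_gap S_sched li lk ik.
have [i [l [_ least [ll _ _] eqS]]] := S_LRL.2 (S j k) (ex_intro _ j av).
have [ij _] := start_inj S_sched ll lk eqS; subst i.
by rewrite -rem; apply: least.
Qed.

Lemma available_unstarted t j : t <= S j 1 ->
  available m L S t j /\ remaining L S t j = L j.
Proof.
move=> tj; have [i|av ->] := available_loop (is_loop1 j) tj; last by rewrite subSS subn0.
by rewrite /is_loop; lia.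
Qed.

Lemma first_start_le i j : S i 1 <= S j 1 -> L i <= L j.
Proof.
move=> /available_unstarted[av rem].
by have := LRL_least (is_loop1 i) av; rewrite rem subSS subn0.
Qed.

Lemma busy j t : t <= S j 1 -> exists i k, is_loop L i k /\ S i k = t.
Proof.
move=> /available_unstarted[av _].
have [i [k [_ _ [lk _ _] eqS]]] := S_LRL.2 t (ex_intro _ j av).
by exists i, k.
Qed.

(** By strong induction on [S j k].  Suppose that LRL starts a loop of another
    job [j'] at time [S j k + m].  No loop of [j'] starts in the [m] slots from
    [S j k] on, since the first of them is taken by [j] and a loop started in
    another would still be running at time [S j k + m]; and by the induction hypothesis an earlier loop of [j'] that is
    still running at time [S j k] would be followed by one of these.  So [j']
    was available at time [S j k] with the same number of remaining loops,
    whereas [j] had one more than at [S j k + m] and was still preferred. *)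
Lemma no_preemption j k : is_loop L j k -> k < L j -> S j k.+1 = S j k + m.
Proof.
have [t] := ubnP (S j k); elim: t j k => // t IH j k; rewrite ltnS => St lk kL.
have lk1 : is_loop L j k.+1 by move: lk; rewrite /is_loop; lia.
set t1 := S j k + m.
have [av rem] : available m L S t1 j /\ remaining L S t1 j = (L j).+1 - k.+1.
  apply: available_loop => //; first exact: (start_gap S_sched lk lk1 (ltnSn k)).
  move=> i li; rewrite ltnS leq_eqVlt => /orP[/eqP-> //|ik].
  by have := start_gap S_sched li lk ik; rewrite /t1; lia.
have [j' [k' [av' least [lk' nst' bef'] eqS]]] := S_LRL.2 t1 (ex_intro _ j av).
have := least j av; rewrite rem.
have [ejj|nejj] := eqVneq j' j.
  subst j'; move=> _.
  suff -> : k.+1 = k' by [].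
  case: (ltngtP k.+1 k') => // [kk'|k'k].
    have := bef' k.+1 lk1 kk'; have := start_gap S_sched lk lk1 (ltnSn k).
    by rewrite /started_before /t1; lia.
  have [ek|k'k1] := eqVneq k' k; first by subst k'; move: eqS; rewrite /t1; lia.
  have := start_gap S_sched lk' lk ltac:(lia); move: eqS; rewrite /t1; lia.
have quiet i : is_loop L j' i -> i < k' -> S j' i < S j k.
  move=> li ik'; have := start_gap S_sched li lk' ik'; rewrite eqS /t1 leq_add2r.
  rewrite leq_eqVlt => /orP[/eqP eqi|//].
  by have [ejj _] := start_inj S_sched li lk eqi; rewrite ejj eqxx in nejj.
have completed i : is_loop L j' i -> i < k' -> S j' i + m <= S j k.
  move=> li ik'; rewrite leqNgt; apply/negP => late.
  have iL : i < L j' by move: lk'; rewrite /is_loop; lia.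
  have li1 : is_loop L j' i.+1 by move: li; rewrite /is_loop; lia.
  have next := IH j' i (leq_trans (quiet i li ik') St) li iL.
  have [ek|ik1] := eqVneq i.+1 k'.
    by have := quiet i li ik'; move: next; rewrite ek eqS /t1; lia.
  by have := quiet i.+1 li1 ltac:(lia); lia.
have tk' : S j k <= S j' k' by rewrite eqS leq_addr.
have [avt remt] := available_loop lk' tk' completed.
have [_ ->] : available m L S t1 j' /\ remaining L S t1 j' = (L j').+1 - k'.
  apply: available_loop => //; first by rewrite eqS.
  by move=> i li ik; have := completed i li ik; rewrite /t1; lia.
have := LRL_least lk avt; rewrite remt; lia.
Qed.

Lemma LRL_completion j : job_completion m L S j = S j 1 + m * L j.
Proof.
have run k : k < L j -> S j k.+1 = S j 1 + m * k.
  elim: k => [|k IH] kL; first by rewrite muln0 addn0.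
  rewrite no_preemption ?IH ?mulnS //; last exact: ltnW; lia.
rewrite /job_completion /loop_completion -[in S j _](prednK (L_gt0 j)) run.
  by rewrite -addnA -mulnSr prednK.
by rewrite prednK.
Qed.

Definition rank j : nat := #|[set i | S i 1 < S j 1]|.

Lemma rank_lt i j : (rank i < rank j) = (S i 1 < S j 1).
Proof.
have mono a b : S a 1 <= S b 1 -> rank a <= rank b.
  by move=> ab; apply/subset_leq_card/subsetP => l; rewrite !inE => /leq_trans; apply.
case: (ltnP (S i 1)) => [ij|/mono]; last by lia.
apply/proper_card/properP; split.
  by apply/subsetP => l; rewrite !inE => /ltn_trans; apply.
by exists i; rewrite !inE ?ltnn.
Qed.

Lemma rank_inj : injective rank.
Proof.
move=> i j eqr; have := rank_lt i j; have := rank_lt j i; rewrite eqr ltnn => ji ij.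
have eqS : S i 1 = S j 1 by lia.
by case: (start_inj S_sched (is_loop1 i) (is_loop1 j) eqS).
Qed.

Lemma rank_ltn j : rank j < n.
Proof.
rewrite -[ltnRHS](card_ord n) -cardsT; apply/proper_card/properP.
by split; [apply: subsetT | exists j; rewrite !inE ?ltnn].
Qed.

Lemma rank_surj p : p < n -> exists j, rank j = p.
Proof.
move=> pn; have inj : injective (fun j => Ordinal (rank_ltn j)).
  by move=> i j [] /rank_inj.
by exists (invF inj (Ordinal pn)); have /(congr1 val) := f_invF inj (Ordinal pn).
Qed.

Definition first_jobs k : {set 'I_n} := [set j | rank j < k].

Lemma sum_first_jobs0 (f : 'I_n -> nat) : \sum_(j in first_jobs 0) f j = 0.
Proof. by rewrite big1 // => j; rewrite inE. Qed.

Lemma sum_first_jobsS (f : 'I_n -> nat) j :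
  \sum_(i in first_jobs (rank j).+1) f i = \sum_(i in first_jobs (rank j)) f i + f j.
Proof.
rewrite (bigD1 j) ?inE //= addnC; congr (_ + _); apply: eq_bigl => i.
by rewrite !inE ltnS -(inj_eq rank_inj) ltn_neqAle andbC.
Qed.

Lemma card_first_jobs k : k <= n -> #|first_jobs k| = k.
Proof.
rewrite -sum1_card; elim: k => [|k IH] kn; first exact: sum_first_jobs0.
by have [j rj] := rank_surj kn; rewrite -rj sum_first_jobsS rj IH ?addn1 // ltnW.
Qed.

(** A job [j] that has not been started by time [t] has been available, so no
    slot up to [t] was idle and [minn m t.+1] jobs are in progress at [t].
    These have started before [j], as have the jobs of [E], which are complete
    and thus different from them. *)
Lemma rank_early_ge t j (E : {set 'I_n}) : t < S j 1 ->
    (forall i, i \in E -> job_completion m L S i <= t) ->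
  #|E| + minn m t.+1 <= rank j.
Proof.
move=> tj doneE.
pose A := [set i | S i 1 <= t < job_completion m L S i].
have cA : minn m t.+1 <= #|A|.
  have busyt v : v <= t -> exists i k, is_loop L i k /\ S i k = v.
    by move=> vt; apply: (@busy j); lia.
  apply: leq_trans (sum_in_progress_ge m busyt) _.
  rewrite -sum1_card [leqRHS]big_mkcond big_set; apply: leq_sum => i _.
  by apply: leq_trans (in_progress_le S_sched _ _) _; rewrite inE; case: ifP.
have disj : E :&: A = set0.
  apply/setP => i; rewrite !inE; apply/negP => /andP[/doneE]; lia.
apply: leq_trans (leq_add (leqnn _) cA) _.
rewrite -cardsUI disj cards0 addn0; apply/subset_leq_card/subsetP => i.
rewrite !inE => /orP[/doneE|]; last by lia.
rewrite LRL_completion; lia.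
Qed.

Lemma start_le_rank j : rank j < m -> S j 1 <= rank j.
Proof.
move=> rm; rewrite leqNgt; apply/negP => lt.
have none i : i \in set0 -> job_completion m L S i <= rank j by rewrite inE.
by have := rank_early_ge lt none; rewrite cards0; lia.
Qed.

(** Otherwise, when [i] completes, the [rank i + 1] jobs of rank at most that of
    [i] are complete and [m] jobs are in progress, one too many for the jobs
    that precede [j]. *)
Lemma start_le_completion i j : rank j = rank i + m ->
  S j 1 <= job_completion m L S i.
Proof.
move=> rj; rewrite leqNgt; apply/negP => lt.
have early l : l \in first_jobs (rank i).+1 ->
    job_completion m L S l <= job_completion m L S i.
  rewrite inE ltnS !LRL_completion => li.
  have Sli : S l 1 <= S i 1 by rewrite leqNgt -rank_lt -leqNgt.
  by rewrite leq_add // leq_mul2l first_start_le ?orbT.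
have := rank_early_ge lt early; rewrite card_first_jobs ?rank_ltn // rj.
 have : m <= job_completion m L S i by rewrite leq_addl.
lia.
Qed.

(** The first [m] ranks contribute at most their own values, and any later job
    is charged to the job whose rank is smaller by [m]. *)
Lemma sum_starts_le k : k <= n ->
  \sum_(j in first_jobs k) S j 1 <=
  \sum_(p < minn k m) p + \sum_(j in first_jobs (k - m)) job_completion m L S j.
Proof.
elim: k => [|k IH] kn; first by rewrite sum_first_jobs0.
have [j rj] := rank_surj kn; have {IH} := IH (ltnW kn).
rewrite -[in leqLHS]rj -[in X in _ -> X <= _]rj sum_first_jobsS rj => IH.
have [km|mk] := ltnP k m.
  move: IH; rewrite !(minn_idPl _) ?(ltnW km) //.
  rewrite (eqP (km : k.+1 - m == 0)) (eqP (ltnW km : k - m == 0)) big_ord_recr /=.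
  by have := @start_le_rank j; rewrite rj sum_first_jobs0 => /(_ km); lia.
have [i ri] : exists i, rank i = k - m by apply: rank_surj; lia.
have := @start_le_completion i j; rewrite rj ri subnK // => /(_ erefl).
move: IH; rewrite !(minn_idPr _) ?(leqW mk) // subSn // -ri sum_first_jobsS; lia.
Qed.

(** * Optimality *)

(** The [minn #|J| m] jobs of [J] that complete last in [S'] pay for the work of
    all of [J] and for the initial loss; the induction hypothesis for the
    remaining jobs pays for the rest. *)
Lemma LRL_first_jobs_le S' (J : {set 'I_n}) : schedule m L S' ->
  \sum_(j in first_jobs #|J|) job_completion m L S j <=
  \sum_(j in J) job_completion m L S' j.
Proof.
move=> sched'; have [k] := ubnP #|J|; elim: k J => // k IH J; rewrite ltnS => Jk.
have [J0|J_gt0] := posnP #|J|; first by rewrite J0 sum_first_jobs0.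
have Jn : #|J| <= n by rewrite -[leqRHS](card_ord n) max_card.
have [T [TJ cT topT]] := exists_top (job_completion m L S') (geq_minl #|J| m).
have cJT : #|J :\: T| = #|J| - m.
  by rewrite cardsDS // cT; move: #|J| => c; lia.
rewrite [leqRHS](big_setID T) /= (setIidPr TJ).
under eq_bigr do rewrite LRL_completion.
rewrite big_split -big_distrr /=.
have {}IH := IH (J :\: T); rewrite cJT in IH.
have {}IH := IH ltac:(move: #|J| J_gt0 Jk => c; lia); move: IH.
have := top_completions_ge sched' TJ cT topT.
have := sum_starts_le Jn.
have : \sum_(j in first_jobs #|J|) L j <= \sum_(j in J) L j.
  apply: exchange_sum; first exact: card_first_jobs.
  move=> i j; rewrite !inE -leqNgt => ri rj; apply: first_start_le.
  by apply: ltnW; rewrite -rank_lt; lia.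
rewrite -(leq_pmul2l m_gt0) => loops starts lower rest.
apply: leq_trans (leq_add starts loops) _.
by rewrite addnAC; apply: leq_add lower rest.
Qed.

End LRL.

Theorem theorem4p7 (m n : nat) (L : 'I_n -> nat)
    (hm : 1 <= m) (hL : forall j : 'I_n, 1 <= L j)
    (S : 'I_n -> nat -> nat) (hS : LRL_schedule m L S) :
  forall S' : 'I_n -> nat -> nat, schedule m L S' ->
    total_completion m L S <= total_completion m L S'.
Proof.
move=> S' sched'; have := LRL_first_jobs_le hm hL hS [set: 'I_n] sched'.
have allj : first_jobs S #|[set: 'I_n]| = [set: 'I_n].
  by apply/setP => j; rewrite cardsT card_ord !inE rank_ltn.
by rewrite allj !big_set.
Qed.
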